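(* The existence of $FD_{n,m}$ does not guarantee the existence of $FD_{n,m+1}$, and the existence of $FD_{n,m+1}$ does not guarantee the existence of $FD_{n,m}$. Specifically: (i) there exist identically distributed random variables $X_1,X_2$ for which $FD_{2,2}$ exists but $FD_{2,1}$ does not exist; (ii) there exist identically distributed random variables $X_1,X_2,X_3$ for which $FD_{3,1}$ exists but $FD_{3,2}$ does not exist.
   Context: For identically distributed random variables $X_1,\ldots,X_n$ with common distribution function $F$, let $x_F:=\sup\{t:F(t)<1\}$ and let $s\nearrow$ mean that $s$ approaches $x_F$ from below. The number of exceedances above $s$ is $N_{s,n}:=\sum_{i=1}^n\mathbf{1}_{(s,\infty)}(X_i)$. The fragility distribution of order $m$ is $FD_{n,m}:=\lim_{s\nearrow}\mathcal{L}(N_{s,n}\mid N_{s,n}\ge m)$; it exists if $FD_{n,m}(A):=\lim_{s\nearrow}\mathbb{P}(N_{s,n}\in A)/\mathbb{P}(N_{s,n}\ge m)$ exists for all $A\subset\{m,m+1,\ldots,n\}$. *)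

(* Defs.v *)
From HB Require Import structures.
From mathcomp Require Import all_boot all_order all_algebra.
From mathcomp Require Import all_classical all_reals all_analysis.

Set Implicit Arguments.
Unset Strict Implicit.
Unset Printing Implicit Defensive.
Import Order.TTheory GRing.Theory Num.Theory.
Import numFieldNormedType.Exports.

Local Open Scope classical_set_scope.
Local Open Scope ring_scope.

(* Only measurable sets are compared: off the sigma-algebra a probability takes
   unconstrained values. *)
Definition identically_distributed (R : realType) (d : measure_display)
    (T : measurableType d) (P : probability T R) (n : nat)
    (X : 'I_n -> {RV P >-> R}) : Prop :=
  forall (i j : 'I_n) (B : set R), measurable B ->
    distribution P (X i) B = distribution P (X j) B.

Definition right_endpoint (R : realType) (F : R -> \bar R) : \bar R :=
  ereal_sup [set t%:E | t in [set t : R | (F t < 1)%E]].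

(* The filter of real s approaching x from below.  The case x = -oo never
   arises for the endpoint of a distribution function, which tends to 0 at -oo. *)
Definition from_below (R : realType) (x : \bar R) : set_system R :=
  match x with
  | r%:E => r^'-
  | +oo%E => pinfty_nbhs R
  | -oo%E => ninfty_nbhs R
  end.

(* Families are indexed by 'I_n.+1 so that the common distribution function
   can be read off X ord0. *)
Definition to_endpoint (R : realType) (d : measure_display)
    (T : measurableType d) (P : probability T R) (n : nat)
    (X : 'I_n.+1 -> {RV P >-> R}) : set_system R :=
  from_below (right_endpoint (cdf (X ord0))).

Definition exceedances (R : realType) (d : measure_display)
    (T : measurableType d) (P : probability T R) (n : nat)
    (X : 'I_n -> {RV P >-> R}) (s : R) (w : T) : nat :=
  (\sum_(i < n) (s < X i w)%R)%N.

(* The conditional law given N_s >= m is meaningful for all s close enough to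
   the endpoint. *)
Definition conditionable (R : realType) (d : measure_display)
    (T : measurableType d) (P : probability T R) (n : nat)
    (X : 'I_n.+1 -> {RV P >-> R}) (m : nat) : Prop :=
  \forall s \near to_endpoint X,
    (0 < P [set w | (m <= exceedances X s w)%N])%E.

(* Since y / 0 = 0, convergence of the quotients alone would make the limits
   exist whenever N_s >= m has probability zero; hence the first conjunct. *)
Definition fragility_distribution_exists (R : realType) (d : measure_display)
    (T : measurableType d) (P : probability T R) (n : nat)
    (X : 'I_n.+1 -> {RV P >-> R}) (m : nat) : Prop :=
  conditionable X m /\
  forall A : set nat, A `<=` [set k | (m <= k <= n.+1)%N] ->
    cvg (fine (P [set w | A (exceedances X s w)])
           / fine (P [set w | (m <= exceedances X s w)%N])
         @[s --> to_endpoint X]).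

(* Main.v *)
Require Import Defs.
From HB Require Import structures.
From mathcomp Require Import all_boot all_order all_algebra.
From mathcomp Require Import all_classical all_reals all_analysis.
From mathcomp Require Import measurable_realfun zify.

Set Implicit Arguments.
Unset Strict Implicit.
Unset Printing Implicit Defensive.
Import Order.TTheory GRing.Theory Num.Theory.
Import numFieldNormedType.Exports.

Local Open Scope classical_set_scope.
Local Open Scope ring_scope.

(** Both examples are built from deterministic sequences on a geometric space.
Under the law [geometric_prob] on [nat] the event [n >= m] has probability
[2^-m].  If levels [Y_0 >= Y_1 >= ...] are nondecreasing functions of [n], the
number of levels exceeding [t] is at least [m] exactly when [n >= c_m(t)] for
some threshold [c_m(t)], so the tail of the exceedance count is [2^-c_m(t)] and
every ratio of interest can be read off the exponents.

The levels have different laws, and [rotation] repairs this: an independent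
uniform rotation of the indices gives every variable the average of the laws
of the [Y_j], while the number of exceedances, being symmetric in the indices,
keeps its law ([identically_distributed_rotation], [exceedances_rotation]).

For (i) the levels are [n] and [n] rounded down to an even number.  Passing
both means that [n] reaches the first even number above [t], so [P(N >= 2) / P(N >= 1)]
alternates between [1/2] and [1] with the parity of [t]
([rotation_nat_oscillation]).  The order equal to the number of variables is
always harmless, as only one value of the count remains
([fragility_distribution_top]).

For (ii) the same oscillation is placed between the second and third levels,
which live at scale [n / 2]: the levels are [n], [n / 2], and [n / 2] rounded
down to an even number.  Since [P(N >= 2) / P(N >= 1)] is now of order [2^-t],
the limit of order 1 is the unit mass at 1 ([fragility_distribution_dirac]),
whereas [P(N >= 3) / P(N >= 2)] alternates between [1/4] and [1]. *)

(** * The geometric law and rotation of indices *)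

Section geometric_law.
Variable R : realType.

Definition geometric_prob : set nat -> \bar R :=
  mseries (fun n => mscale (2^-1 ^+ n.+1)%:nng (@dirac _ nat n R)) 0.

HB.instance Definition _ := Measure.on geometric_prob.

Lemma geometric_probE A :
  (geometric_prob A = \sum_(n <oo) (2^-1 ^+ n.+1 * \1_A n)%:E)%E.
Proof. by []. Qed.

Lemma geometric_prob_tail m :
  geometric_prob [set n | (m <= n)%N] = (2^-1 ^+ m)%:E.
Proof.
rewrite geometric_probE (nneseries_split 0 m); last first.
  by move=> n _; rewrite lee_fin mulr_ge0 // indicE.
rewrite add0n big_nat big1 => [|n /andP[_ nm]]; last first.
  by rewrite indicE memNset ?mulr0//=; apply/negP; rewrite -ltnNge.
rewrite add0e -nneseries_addn => [|n]; last first.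
  by rewrite lee_fin mulr_ge0 // indicE.
have /(cvg_lim (@ereal_hausdorff R)) := @cvg_geometric_eseries_half R 1 m.
rewrite div1r exprVn => <-; apply/congr_lim/funext => n.
apply: eq_bigr => i _.
rewrite indicE mem_set ?mulr1/= ?leq_addl//.
by rewrite div1r natrX addnS exprVn.
Qed.

Lemma geometric_prob_setT : geometric_prob setT = 1%E.
Proof.
by rewrite -[RHS](geometric_prob_tail 0); congr geometric_prob; apply/seteqP.
Qed.

HB.instance Definition _ := Measure_isProbability.Build _ _ _
  geometric_prob geometric_prob_setT.

End geometric_law.

Section rotation.
Variables (R : realType) (k : nat) (Y : 'I_k.+1 -> nat -> R).

(** Encodes the pair (sequence index [n], rotation [r]) as a single number. *)
Definition interleave (r n : nat) : nat := (n * k.+1 + r)%N.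

Let measurable_interleave r : measurable_fun [set: nat] (interleave r).
Proof. by []. Qed.

HB.instance Definition _ r :=
  isMeasurableFun.Build _ _ _ _ (interleave r) (measurable_interleave r).

(** The image of geometric law times uniform rotation under [interleave].
Working on [nat], where every set is measurable, makes all measurability
conditions void. *)
Definition rotation_prob : set nat -> \bar R :=
  mscale (k.+1%:R^-1)%:nng
    (msum (fun r => distribution (geometric_prob R) (interleave r)) k.+1).

HB.instance Definition _ := Measure.on rotation_prob.

Lemma rotation_probE A : rotation_prob A =
  (k.+1%:R^-1%:E * \sum_(r < k.+1) geometric_prob R (interleave r @^-1` A))%E.
Proof. by []. Qed.

Lemma rotation_prob_const A B :
  (forall r : 'I_k.+1, interleave r @^-1` A = B) ->
  rotation_prob A = geometric_prob R B.
Proof.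
move=> AB; have <- : (fine (geometric_prob R B))%:E = geometric_prob R B.
  by rewrite fineK// fin_num_measure.
rewrite rotation_probE (eq_bigr (fun=> (fine (geometric_prob R B))%:E)).
  rewrite sumEFin sumr_const card_ord -EFinM -[fine _ *+ _]mulr_natl mulrA mulVf ?mul1r//.
by move=> r _; rewrite AB fineK// fin_num_measure.
Qed.

Lemma rotation_prob_setT : rotation_prob setT = 1%E.
Proof.
by rewrite (@rotation_prob_const _ setT) ?geometric_prob_setT.
Qed.

HB.instance Definition _ := Measure_isProbability.Build _ _ _
  rotation_prob rotation_prob_setT.

(** The same set function as an element of [probability], so that random
variables over it refer to the bundled law. *)
Definition rotation_law : probability nat R := rotation_prob.

(** [inZp w] is the rotation and [w %/ k.+1] the sequence index encoded in
[w]; the addition of ordinals is modulo [k.+1]. *)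
Definition rotation_var (i : 'I_k.+1) (w : nat) : R :=
  Y (i + inZp w) (w %/ k.+1)%N.

Let measurable_rotation_var i : measurable_fun [set: nat] (rotation_var i).
Proof. by []. Qed.

HB.instance Definition _ i :=
  isMeasurableFun.Build _ _ _ _ (rotation_var i) (measurable_rotation_var i).

Definition rotation (i : 'I_k.+1) : {RV rotation_law >-> R} := rotation_var i.

Lemma rotation_var_interleave i (r : 'I_k.+1) n :
  rotation_var i (interleave r n) = Y (i + r) n.
Proof.
rewrite /rotation_var /interleave divnMDl// divn_small// addn0.
congr (Y (i + _) n); apply/val_inj => /=.
by rewrite modnMDl modn_small.
Qed.

(** For fixed [i], [i + r] runs over all indices as [r] does; hence the average
on the right does not involve [i]. *)
Lemma distribution_rotation i B : distribution rotation_law (rotation i) B =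
  (k.+1%:R^-1%:E * \sum_(j < k.+1) geometric_prob R (Y j @^-1` B))%E.
Proof.
rewrite /distribution /pushforward [LHS]rotation_probE; congr (_ * _)%E.
rewrite [RHS](reindex_inj (addrI i)); apply: eq_bigr => r _.
congr (geometric_prob R _); apply/funext => n /=.
by rewrite /preimage /= rotation_var_interleave.
Qed.

Lemma identically_distributed_rotation : identically_distributed rotation.
Proof. by move=> i j B _; rewrite !distribution_rotation. Qed.

(** Rotating the indices permutes the terms of the count, so that its value
depends on the sequence index only. *)
Lemma exceedances_rotation s (A : set nat) :
  rotation_law [set w | A (exceedances rotation s w)] =
  geometric_prob R [set n | A (\sum_(j < k.+1) (s < Y j n)%R)%N].
Proof.
apply: rotation_prob_const => r; apply/funext => n /=; congr A.
rewrite [RHS](reindex_inj (addIr r)); apply: eq_bigr => j _ /=.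
by rewrite rotation_var_interleave.
Qed.

End rotation.

(** * Criteria for existence of the fragility distribution *)

Section exceedances_theory.
Context (R : realType) (d : measure_display) (T : measurableType d)
  (P : probability T R) (n : nat) (X : 'I_n -> {RV P >-> R}).

Lemma measurable_exceedances s (A : set nat) :
  measurable [set w | A (exceedances X s w)].
Proof.
suff mN : measurable_fun [set: T] (exceedances X s).
  by rewrite -[X in measurable X]setTI; exact: mN.
rewrite /exceedances; elim: (index_enum _) => [|i r IH].
  by under eq_fun do rewrite big_nil; exact: measurable_cst.
under eq_fun do rewrite big_cons; apply: measurable_fun_addn => //.
apply: (@measurableT_comp _ _ _ _ _ _ nat_of_bool) => //.
exact: measurable_fun_ltr.
Qed.

Lemma exceedances_le s w : (exceedances X s w <= n)%N.
Proof.
rewrite -[leqRHS]card_ord -sum1_card; apply: leq_sum => i _.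
exact: leq_b1.
Qed.

End exceedances_theory.

Section fragility.
Context (R : realType) (d : measure_display) (T : measurableType d)
  (P : probability T R) (n : nat) (X : 'I_n.+1 -> {RV P >-> R}).

#[local] Instance to_endpoint_filter : Filter (to_endpoint X).
Proof.
by rewrite /to_endpoint; case: right_endpoint => [r| |] /=; exact: _.
Qed.

(** A law charging every right half-line has a distribution function below 1
everywhere, hence an infinite endpoint. *)
Lemma to_endpoint_pinfty :
  (forall t, (0 < distribution P (X ord0) `]t, +oo[)%E) ->
  to_endpoint X = pinfty_nbhs R.
Proof.
move=> X_gt; rewrite /to_endpoint /right_endpoint.
rewrite (_ : ereal_sup _ = +oo%E) //; apply/eqyP => t _.
apply: ereal_sup_ubound; exists t => //=.
have := X_gt t; rewrite -setCitvl probability_setC// sube_gt0.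
by rewrite /cdf.
Qed.

Local Notation p A s := (fine (P [set w | A (exceedances X s w)])).

Lemma exceedances_prob_le (A B : set nat) s :
  (forall k, (k <= n.+1)%N -> A k -> B k) -> p A s <= p B s.
Proof.
move=> AB; apply: fine_le; [| |apply: le_measure];
  rewrite ?fin_num_measure ?inE//; try exact: measurable_exceedances.
by move=> w /=; apply: AB; exact: exceedances_le.
Qed.

Lemma eq_exceedances_prob (A B : set nat) s :
  (forall k, (k <= n.+1)%N -> A k <-> B k) -> p A s = p B s.
Proof.
by move=> AB; apply/le_anti/andP; split; apply: exceedances_prob_le => k /AB[].
Qed.

Lemma exceedances_probD (A B : set nat) s :
  p B s = p (A `&` B) s + p (B `\` A) s.
Proof.
have mE C := measurable_exceedances X s C.
rewrite -fineD ?fin_num_measure//; try exact: mE.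
rewrite -measureU; [|exact: mE|exact: mE|].
  congr (fine (P _)); apply/seteqP; split => w /=.
    by move=> Bw; have [Aw|nAw] := pselect (A (exceedances X s w)); [left|right].
  by case=> -[].
by apply/seteqP; split => w //= -[[? _] []].
Qed.

Lemma fine_conditionable m : conditionable X m ->
  \forall s \near to_endpoint X, 0 < p (fun k => is_true (m <= k)%N) s.
Proof.
apply: filterS => s Ps; rewrite fine_gt0// Ps /=.
rewrite -ge0_fin_numE ?measure_ge0// fin_num_measure//.
exact: (measurable_exceedances X s (fun k => is_true (m <= k)%N)).
Qed.

(** The count never exceeds [n.+1], so conditioning on reaching it leaves a
unit mass: the quotients are eventually 0 or 1. *)
Lemma fragility_distribution_top : conditionable X n.+1 ->
  fragility_distribution_exists X n.+1.
Proof.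
move=> cX; split=> // A sA; have [An|nAn] := pselect (A n.+1).
  apply: (is_cvg_near_cst (1 : R)).
  apply: filterS (fine_conditionable cX) => s Ps.
  rewrite (@eq_exceedances_prob A (fun k => is_true (n.+1 <= k)%N)).
    by rewrite divff// gt_eqF.
  move=> k kn; split=> [/sA/andP[]//|nk].
  by rewrite (_ : k = n.+1) //; apply/eqP; rewrite eqn_leq kn.
apply: (is_cvg_near_cst (0 : R)); apply: nearW => s.
rewrite (@eq_exceedances_prob A set0) ?measure0 ?mul0r// => k _.
split=> // Ak; apply: nAn; have /andP[nk kn] := sA _ Ak.
by rewrite (_ : n.+1 = k) //; apply/eqP; rewrite eqn_leq kn andbT.
Qed.

(** If exceeding the order [m] strictly is negligible, the conditional law
concentrates at [m]: a set avoiding [m] gets a quotient squeezed to 0, and a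
set containing [m] is handled through its complement. *)
Lemma fragility_distribution_dirac m : conditionable X m ->
  p (fun k => is_true (m < k)%N) s / p (fun k => is_true (m <= k)%N) s
    @[s --> to_endpoint X] --> (0 : R) ->
  fragility_distribution_exists X m.
Proof.
move=> cX gt0; split=> // A sA.
have small (B : set nat) : (forall k, B k -> (m < k)%N) ->
    p B s / p (fun k => is_true (m <= k)%N) s
      @[s --> to_endpoint X] --> (0 : R).
  move=> Bm; apply: (squeeze_cvgr _ (cvg_cst (0 : R)) gt0).
  apply: filterS (fine_conditionable cX) => s Ps.
  rewrite divr_ge0 ?fine_ge0 ?measure_ge0 //=.
  rewrite ler_pM2r ?invr_gt0//.
  by apply: (@exceedances_prob_le B (fun k => is_true (m < k)%N)) => k _ /Bm.
have [Am|nAm] := pselect (A m); last first.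
  apply/cvg_ex; exists 0; apply: small => k Ak.
  have /andP[mk _] := sA _ Ak; rewrite ltn_neqAle mk andbT.
  by apply/eqP => mk'; apply: nAm; rewrite mk'.
have gtA : p ((fun k => is_true (m <= k)%N) `\` A) s
             / p (fun k => is_true (m <= k)%N) s
             @[s --> to_endpoint X] --> (0 : R).
  apply: small => k [mk nAk]; rewrite ltn_neqAle mk andbT.
  by apply/eqP => mk'; apply: nAk; rewrite -mk'.
apply/cvg_ex; exists (1 - 0).
apply: (cvg_trans _ (cvgB (cvg_cst (1 : R)) gtA)).
apply: near_eq_cvg.
apply: filterS (fine_conditionable cX) => s Ps.
suff -> : p A s = p (fun k => is_true (m <= k)%N) s
                  - p ((fun k => is_true (m <= k)%N) `\` A) s.
  by rewrite mulrBl divff ?gt_eqF.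
rewrite (exceedances_probD A (fun k => is_true (m <= k)%N)) addrK.
apply: eq_exceedances_prob => k _; split=> [Ak|[]//]; split=> //.
by have /andP[] := sA _ Ak.
Qed.

End fragility.

(** Even and odd integers both tend to infinity, so a limit would have to be
both [a] and [b]. *)
Lemma parity_not_cvg (R : realType) (f : R -> R) (a b : R) : a != b ->
  (forall j, f j.*2%:R = a) -> (forall j, f j.*2.+1%:R = b) ->
  ~ cvg (f @ +oo).
Proof.
move=> /eqP ab fa fb /cvg_ex[l fl]; apply: ab.
have sub (u : nat -> nat) c : (forall j, (j <= u j)%N) ->
    (forall j, f (u j)%:R = c) -> c = l.
  move=> uj fu; have uy : (u j)%:R @[j --> \oo] --> (+oo : set_system R).
    apply/cvgryPge => M; near=> j; apply: (@le_trans _ _ j%:R).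
      by near: j; exact: nbhs_infty_ger.
    by rewrite ler_nat.
  have := cvg_comp _ _ uy fl; rewrite (_ : f \o _ = cst c) => [|]; last first.
    by apply/funext => j /=; exact: fu.
  have cc : cst c @ \oo --> (c : R) by exact: cvg_cst.
  by move=> cl; exact: (cvg_unique (@Rhausdorff R) cc cl).
rewrite (sub double a _ fa) => [|j]; last by rewrite -addnn leq_addr.
rewrite (sub (fun j => j.*2.+1) b _ fb)// => j.
by rewrite -addnn leqW// leq_addr.
Unshelve. all: by end_near. Qed.

(** * Examples with integer levels *)

Section rotation_nat.
Variables (R : realType) (k : nat) (Y : 'I_k.+1 -> nat -> nat).

Let X := rotation (fun j n => (Y j n)%:R : R).

Definition count_above (t n : nat) : nat := (\sum_(j < k.+1) (t < Y j n))%N.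

(** Integer levels only see the integer part of [s]; the hypothesis names the
threshold [c t] from which on at least [m] levels exceed [t]. *)
Lemma rotation_nat_tail m (c : nat -> nat) s :
  (forall t n, (m <= count_above t n)%N = (c t <= n)%N) -> 0 <= s ->
  rotation_law R k [set w | (m <= exceedances X s w)%N] =
  (2^-1 ^+ c (Num.truncn s))%:E.
Proof.
move=> Yc s0; rewrite (exceedances_rotation _ _ (fun i => is_true (m <= i)%N)).
rewrite -geometric_prob_tail; congr (geometric_prob R _).
apply/funext => n /=; rewrite -Yc /count_above; congr (is_true (m <= _)%N).
by apply: eq_bigr => j _; rewrite truncn_lt_nat.
Qed.

(* The level [n] itself is unbounded, and the averaged law inherits this. *)
Hypothesis Y0 : forall n, Y ord0 n = n.

Lemma rotation_nat_endpoint : to_endpoint X = pinfty_nbhs R.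
Proof.
apply: to_endpoint_pinfty => t; rewrite distribution_rotation mule_gt0//.
rewrite (bigD1 ord0)//=.
have tail_gt0 : (0 < geometric_prob R [set n | (Num.truncn t < n)%N])%E.
  by rewrite geometric_prob_tail lte_fin exprn_gt0.
apply: (lt_le_trans tail_gt0); apply: (@le_trans _ _ _ _ _ _ (leeDl _ _)).
  apply: le_measure; rewrite ?inE// => n /= tn.
  rewrite in_itv/= andbT Y0; apply: lt_le_trans (truncnS_gt _) _.
  by rewrite ler_nat.
by apply: sume_ge0.
Qed.

Lemma rotation_nat_conditionable m (c : nat -> nat) :
  (forall t n, (m <= count_above t n)%N = (c t <= n)%N) -> conditionable X m.
Proof.
move=> Yc; rewrite /conditionable rotation_nat_endpoint.
near=> s; rewrite (rotation_nat_tail Yc) ?lte_fin ?exprn_gt0//.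
Unshelve. all: by end_near. Qed.

(** The set [{k.+1}] already obstructs convergence: its quotient at an integer
[t] is [2^-(c' t - c t)], which is [2^-(e+1)] for even [t] and 1 for odd [t]. *)
Lemma rotation_nat_oscillation m e (c c' : nat -> nat) : (m <= k.+1)%N ->
  (forall t n, (m <= count_above t n)%N = (c t <= n)%N) ->
  (forall t n, (k.+1 <= count_above t n)%N = (c' t <= n)%N) ->
  (forall j, c' j.*2 = (c j.*2 + e.+1)%N) ->
  (forall j, c' j.*2.+1 = c j.*2.+1) ->
  ~ fragility_distribution_exists X m.
Proof.
move=> mk Yc Yc' even_gap odd_gap [_ /(_ [set k.+1])].
rewrite rotation_nat_endpoint => /(_ _); apply/not_implyP; split.
  by move=> i /= ->; rewrite mk leqnn.
have ratioE (t : nat) : fine (rotation_law R k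
      [set w | [set k.+1] (exceedances X t%:R w)]) /
    fine (rotation_law R k [set w | (m <= exceedances X t%:R w)%N]) =
    2^-1 ^+ c' t / 2^-1 ^+ c t.
  rewrite (@eq_exceedances_prob _ _ _ _ _ _ _ (fun i => is_true (k.+1 <= i)%N)).
    by rewrite (rotation_nat_tail Yc) ?(rotation_nat_tail Yc')// natrK.
  move=> i ik /=; split=> [->//|ki].
  by apply/eqP; rewrite eqn_leq ik.
have half_neq0 n : 2^-1 ^+ n != 0 :> R by rewrite expf_neq0 ?invr_eq0 ?pnatr_eq0.
apply: (@parity_not_cvg _ _ (2^-1 ^+ e.+1) 1) => [|j|j].
- by rewrite lt_eqF// exprn_ilt1 ?invr_ge0// invf_lt1// ltr1n.
- by rewrite ratioE even_gap exprD mulrAC divff ?mul1r.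
- by rewrite ratioE odd_gap divff.
Qed.

(** The gap makes the quotient of successive tails at most [2^-t]. *)
Lemma rotation_nat_dirac m (c c' : nat -> nat) :
  (forall t n, (m <= count_above t n)%N = (c t <= n)%N) ->
  (forall t n, (m < count_above t n)%N = (c' t <= n)%N) ->
  (forall t, (c t + t <= c' t)%N) ->
  fragility_distribution_exists X m.
Proof.
move=> Yc Yc' gap; apply: fragility_distribution_dirac.
  exact: rotation_nat_conditionable Yc.
rewrite rotation_nat_endpoint.
have pow0 : 2^-1 ^+ Num.truncn s @[s --> (+oo : set_system R)] --> (0 : R).
  have truncy : Num.truncn s @[s --> (+oo : set_system R)] --> \oo.
    by apply/cvgnyPge => N; near=> s; rewrite truncn_ge_nat.
  have expr0 : (2^-1 : R) ^+ n @[n --> \oo] --> (0 : R).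
    by apply: cvg_expr; rewrite ger0_norm ?invr_ge0// invf_lt1// ltr1n.
  exact: (cvg_comp _ _ truncy expr0).
apply: (squeeze_cvgr _ (cvg_cst (0 : R)) pow0); near=> s.
have s0 : 0 <= s by [].
rewrite (rotation_nat_tail Yc)// (rotation_nat_tail Yc') //=.
rewrite divr_ge0 ?exprn_ge0//= ler_pdivrMr ?exprn_gt0// -exprD.
by rewrite ler_wiXn2l ?invr_ge0 ?invf_le1 ?ler1n// addnC.
Unshelve. all: by end_near. Qed.

End rotation_nat.

(** * The two families *)

Definition two_levels (j : 'I_2) (n : nat) : nat :=
  if val j is 0 then n else n./2.*2.

Definition three_levels (j : 'I_3) (n : nat) : nat :=
  match val j with 0 => n | 1 => n./2 | _ => n./2./2.*2 end.

Theorem mainTheorem2 (R : realType) :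
  (exists (d : measure_display) (T : measurableType d) (P : probability T R)
          (X : 'I_2 -> {RV P >-> R}),
     [/\ identically_distributed X,
         fragility_distribution_exists X 2
       & ~ fragility_distribution_exists X 1])
  /\
  (exists (d : measure_display) (T : measurableType d) (P : probability T R)
          (X : 'I_3 -> {RV P >-> R}),
     [/\ identically_distributed X,
         fragility_distribution_exists X 1,
         conditionable X 2
       & ~ fragility_distribution_exists X 2]).
Proof.
split.
  have c1 t n : (1 <= count_above two_levels t n)%N = (t.+1 <= n)%N.
    rewrite /count_above !big_ord_recl big_ord0 /two_levels /=; lia.
  have c2 t n : (2 <= count_above two_levels t n)%N = (t./2.+1.*2 <= n)%N.
    rewrite /count_above !big_ord_recl big_ord0 /two_levels /=; lia.
  exists _, nat, (rotation_law R 1), (rotation (fun j n => (two_levels j n)%:R)).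
  split.
  - exact: identically_distributed_rotation.
  - by apply: fragility_distribution_top; exact: rotation_nat_conditionable c2.
  - by apply: (@rotation_nat_oscillation _ _ _ _ 1 0 _ _ _ c1 c2) => // j; lia.
have c1 t n : (1 <= count_above three_levels t n)%N = (t.+1 <= n)%N.
  rewrite /count_above !big_ord_recl big_ord0 /three_levels /=; lia.
have c2 t n : (2 <= count_above three_levels t n)%N = (t.+1.*2 <= n)%N.
  rewrite /count_above !big_ord_recl big_ord0 /three_levels /=; lia.
have c3 t n : (3 <= count_above three_levels t n)%N = (t./2.+1.*2.*2 <= n)%N.
  rewrite /count_above !big_ord_recl big_ord0 /three_levels /=; lia.
exists _, nat, (rotation_law R 2), (rotation (fun j n => (three_levels j n)%:R)).
split.
- exact: identically_distributed_rotation.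
- by apply: (@rotation_nat_dirac _ _ _ _ 1 _ _ c1 c2) => // t; lia.
- exact: rotation_nat_conditionable c2.
- by apply: (@rotation_nat_oscillation _ _ _ _ 2 1 _ _ _ c2 c3) => // j; lia.
Qed.
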